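(* Let $G=\langle X\mid R\rangle$ be a finitely presented group with Miller Machine $M(G)$. For $n\ge 2$ let $D_0(n)$ be the maximum, over all $u\in\langle X\rangle_{M(G)}$ with $\|u\|\le n-2$ such that $q$ and $qu$ are conjugate in $M(G)$, of the minimal length $|\gamma|$ of an element $\gamma\in M(G)$ conjugating $qu$ to $q$. Then $D_0(n)$ is within a constant factor of $\Lambda(n-2)$. More precisely, if $t=\max(\{\|r\|:r\in R\}\cup\{2\})$, then for all $n>2$, $$\frac{\Lambda(n-2)}{3t}\le D_0(n)\le \Lambda(n-2).$$
   Context: Standing assumptions: $X,R$ are finite, $R\neq\emptyset$ is a set of words on $X^{\pm1}$, and $X\cap R=\emptyset$. The Miller Machine $M(G)$ (which depends on the presentation) is the group generated by $X\cup\Theta\cup\{q\}$, where $\Theta=\{\theta_\alpha:\alpha\in X\cup R\}$ and $q$ are new letters, with defining relations: $\theta_\alpha x=x\theta_\alpha$ ($x\in X$, $\alpha\in X\cup R$); $\theta_x xq=qx\theta_x$ ($x\in X$); $\theta_r q=qr\theta_r$ ($r\in R$). $|\gamma|$ denotes word length in $M(G)$ with respect to $X\cup\Theta\cup\{q\}$. The subgroup $\langle X,q\rangle_{M(G)}$ is free on $X\cup\{q\}$, and $\|\cdot\|$ denotes length in free groups (here, of elements of $F(X)=\langle X\rangle_{M(G)}$). The function $\Lambda$: for an expression $w=\prod_{j=1}^m w_jr_jw_j^{-1}$ with $r_j\in R^{\pm1}$, $w_j\in F(X)$, let $f(w)=m+\|w_1\|+\|w_m\|+\sum_{i=1}^{m-1}\|w_i^{-1}w_{i+1}\|$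 (and $f=0$ for the empty expression, $m=0$). For $g$ in the normal closure $\langle\langle R\rangle\rangle$ of $R$ in $F(X)$, $\lambda(g)$ is the smallest $f(w)$ over all such expressions $w$ equal to $g$ in $F(X)$. $\Lambda(n)$ is the maximum of $\lambda(g)$ over $g\in F(X)$ with $g=_G1$ and $\|g\|\le n$. *)

(* Defs.v *)
From HB Require Import structures.
From mathcomp Require Import all_boot finmap.
From mathcomp Require Import boolp classical_sets.

Set Implicit Arguments.
Unset Strict Implicit.
Unset Printing Implicit Defensive.

Local Open Scope classical_set_scope.
Local Open Scope quotient_scope.
Local Open Scope group_scope.

(* Words on A^{+-1}: the letter (a, false) is a and (a, true) is a^-1. *)
Notation word A := (seq (A * bool)).

Definition letter_inv {A : Type} (l : A * bool) : A * bool := (l.1, ~~ l.2).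

Definition word_inv {A : Type} (w : word A) : word A :=
  rev (map letter_inv w).

(* A presentation is given by its generators A and its defining relations
   l = r, for rel l r. *)
Inductive pres_eq {A : Type} (rel : word A -> word A -> Prop) :
    word A -> word A -> Prop :=
| pres_refl w : pres_eq rel w w
| pres_sym v w : pres_eq rel v w -> pres_eq rel w v
| pres_trans v w z : pres_eq rel v w -> pres_eq rel w z -> pres_eq rel v z
| pres_cancel v w l : pres_eq rel (v ++ [:: l; letter_inv l] ++ w) (v ++ w)
| pres_rel v w l r : rel l r -> pres_eq rel (v ++ l ++ w) (v ++ r ++ w).

Section PresentedGroup.
Variables (A : choiceType) (rel : word A -> word A -> Prop).
Implicit Types v w : word A.

Definition pres_eqb v w : bool := `[< pres_eq rel v w >].

Lemma pres_eqb_refl : reflexive pres_eqb.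
Proof. by move=> w; apply/asboolP; exact: pres_refl. Qed.

Lemma pres_eqb_sym : symmetric pres_eqb.
Proof. by move=> v w; apply/asboolP/asboolP; exact: pres_sym. Qed.

Lemma pres_eqb_trans : transitive pres_eqb.
Proof.
by move=> w v z /asboolP vw /asboolP wz; apply/asboolP; exact: pres_trans wz.
Qed.

Canonical pres_equiv := EquivRel pres_eqb pres_eqb_refl pres_eqb_sym
  pres_eqb_trans.

Definition pgroup : Type := {eq_quot pres_equiv}.
HB.instance Definition _ := Choice.on pgroup.
HB.instance Definition _ := EqQuotient.on pgroup.

(* The element of the presented group represented by a word. *)
Definition cls w : pgroup := \pi_pgroup w.

Lemma clsP v w : cls v = cls w <-> pres_eq rel v w.
Proof.
split=> [vw | vw]; last by apply/eqmodP/asboolP.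
by apply/asboolP; have /eqmodP := vw.
Qed.

Lemma reprcls w : pres_eq rel (repr (cls w)) w.
Proof. by apply/clsP; rewrite /cls reprK. Qed.

Lemma pres_eq_cat2l u v w : pres_eq rel v w -> pres_eq rel (u ++ v) (u ++ w).
Proof.
elim=> [x|x y _|x y z _ xy _|x y l|x y l r lr].
- exact: pres_refl.
- exact: pres_sym.
- exact: pres_trans.
- by rewrite (catA u x) (catA u x); exact: pres_cancel.
- by rewrite !(catA u x); exact: pres_rel.
Qed.

Lemma pres_eq_cat2r u v w : pres_eq rel v w -> pres_eq rel (v ++ u) (w ++ u).
Proof.
elim=> [x|x y _|x y z _ xy _|x y l|x y l r lr].
- exact: pres_refl.
- exact: pres_sym.
- exact: pres_trans.
- by rewrite -!catA; exact: pres_cancel.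
- by rewrite -!catA; exact: pres_rel.
Qed.

Lemma pres_eq_cat u v w z :
  pres_eq rel u v -> pres_eq rel w z -> pres_eq rel (u ++ w) (v ++ z).
Proof.
move=> uv wz; apply: (pres_trans (w := v ++ w)).
- exact: pres_eq_cat2r.
- exact: pres_eq_cat2l.
Qed.

Lemma letter_invK : involutive (@letter_inv A).
Proof. by case=> a b; rewrite /letter_inv /= negbK. Qed.

Lemma word_inv_cat v w : word_inv (v ++ w) = word_inv w ++ word_inv v.
Proof. by rewrite /word_inv map_cat rev_cat. Qed.

Lemma word_invK : involutive (@word_inv A).
Proof.
by move=> w; rewrite /word_inv map_rev revK -map_comp map_id_in // => l _ /=;
  rewrite letter_invK.
Qed.

Lemma word_inv_cons l w : word_inv (l :: w) = word_inv w ++ [:: letter_inv l].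
Proof. by rewrite -cat1s word_inv_cat. Qed.

Lemma pres_eq_invr w : pres_eq rel (w ++ word_inv w) [::].
Proof.
elim: w => [|l w IHw]; first exact: pres_refl.
rewrite word_inv_cons /=; apply: pres_trans (pres_cancel rel [::] [::] l).
rewrite catA -cat1s -[_ ++ _ ++ [::]](cat1s l [:: letter_inv l]).
exact/pres_eq_cat2l/(pres_eq_cat2r _ IHw).
Qed.

Lemma pres_eq_invl w : pres_eq rel (word_inv w ++ w) [::].
Proof. by rewrite -{2}(word_invK w); exact: pres_eq_invr. Qed.

Lemma pres_eq_inv v w :
  pres_eq rel v w -> pres_eq rel (word_inv v) (word_inv w).
Proof.
move=> vw; apply: (pres_trans (w := word_inv v ++ (w ++ word_inv w))).
  apply: pres_sym; rewrite -[X in pres_eq _ _ X]cats0.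
  exact/pres_eq_cat2l/pres_eq_invr.
rewrite catA -[X in pres_eq _ _ X]cat0s; apply: pres_eq_cat2r.
apply: pres_trans (pres_eq_invl v).
exact/pres_eq_cat2l/pres_sym.
Qed.

Definition pgroup_one : pgroup := cls [::].
Definition pgroup_mul (g h : pgroup) : pgroup := cls (repr g ++ repr h).
Definition pgroup_inv (g : pgroup) : pgroup := cls (word_inv (repr g)).

Lemma cls_cat v w : cls (v ++ w) = pgroup_mul (cls v) (cls w).
Proof. by apply/clsP; apply: pres_eq_cat; apply/pres_sym/reprcls. Qed.

Lemma cls_word_inv w : cls (word_inv w) = pgroup_inv (cls w).
Proof. by apply/clsP; apply/pres_eq_inv/pres_sym/reprcls. Qed.

Lemma cls_repr (g : pgroup) : cls (repr g) = g.
Proof. by rewrite /cls reprK. Qed.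

Lemma pgroup_mulA : associative pgroup_mul.
Proof.
move=> x y z; rewrite -(cls_repr x) -(cls_repr y) -(cls_repr z).
by rewrite -!cls_cat catA.
Qed.

Lemma pgroup_mul1g : left_id pgroup_one pgroup_mul.
Proof. by move=> x; rewrite -(cls_repr x) -cls_cat. Qed.

Lemma pgroup_mulg1 : right_id pgroup_one pgroup_mul.
Proof. by move=> x; rewrite -(cls_repr x) -cls_cat cats0. Qed.

Lemma pgroup_mulVg : left_inverse pgroup_one pgroup_inv pgroup_mul.
Proof.
move=> x; rewrite -(cls_repr x) -cls_word_inv -cls_cat.
exact/clsP/pres_eq_invl.
Qed.

Lemma pgroup_mulgV : right_inverse pgroup_one pgroup_inv pgroup_mul.
Proof.
move=> x; rewrite -(cls_repr x) -cls_word_inv -cls_cat.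
exact/clsP/pres_eq_invr.
Qed.

HB.instance Definition _ := isGroup.Build pgroup
  pgroup_mulA pgroup_mul1g pgroup_mulg1 pgroup_mulVg pgroup_mulgV.

Definition pgen (a : A) : pgroup := cls [:: (a, false)].

Lemma clsM v w : cls (v ++ w) = cls v * cls w.
Proof. exact: cls_cat. Qed.

Lemma clsV w : cls (word_inv w) = (cls w)^-1.
Proof. exact: cls_word_inv. Qed.

Lemma cls1 : cls [::] = 1.
Proof. by []. Qed.

End PresentedGroup.

(* Minimum of a nonempty set of naturals; maximum of a nonempty bounded one. *)
Definition min_nat (S : set nat) : nat :=
  xget 0%N [set m | S m /\ forall k, S k -> (m <= k)%N].

Definition max_nat (S : set nat) : nat :=
  xget 0%N [set m | S m /\ forall k, S k -> (k <= m)%N].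

Lemma min_natP (S : set nat) : S !=set0 ->
  S (min_nat S) /\ forall k, S k -> (min_nat S <= k)%N.
Proof.
case=> k Sk; apply: (@xgetPex _ 0%N [set m | S m /\ forall k, S k -> (m <= k)%N]).
have exS : exists k, `[< S k >] by exists k; apply/asboolP.
case: (ex_minnP exS) => m /asboolP Sm minm.
by exists m; split=> // j Sj; apply: minm; apply/asboolP.
Qed.

Lemma max_natP (S : set nat) b : S !=set0 -> (forall k, S k -> (k <= b)%N) ->
  S (max_nat S) /\ forall k, S k -> (k <= max_nat S)%N.
Proof.
case=> k Sk Sb.
apply: (@xgetPex _ 0%N [set m | S m /\ forall k, S k -> (k <= m)%N]).
have exS : exists k, `[< S k >] by exists k; apply/asboolP.
have bS j : `[< S j >] -> (j <= b)%N by move=> /asboolP /Sb.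
case: (ex_maxnP exS bS) => m /asboolP Sm maxm.
by exists m; split=> // j Sj; apply: maxm; apply/asboolP.
Qed.

(* Word length with respect to the generators of the presentation. *)
Definition len (A : choiceType) (rel : word A -> word A -> Prop)
    (g : pgroup rel) : nat :=
  min_nat [set size w | w in [set w | cls rel w = g]].

Definition no_rel (A : Type) (l r : word A) : Prop := False.

(* For the free group, len is the length of the reduced word. *)
Definition free (A : choiceType) : Type := pgroup (@no_rel A).
HB.instance Definition _ (A : choiceType) := Group.on (free A).

Definition fcls (A : choiceType) (w : word A) : free A := cls (@no_rel A) w.

(* The homomorphism on the free group extending f : A -> H. *)
Definition word_eval (A : choiceType) (H : groupType) (f : A -> H)
    (w : word A) : H :=
  \prod_(l <- w) (if l.2 then (f l.1)^-1 else f l.1).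

Definition free_lift (A : choiceType) (H : groupType) (f : A -> H)
    (g : free A) : H := word_eval f (repr g).

Section FreeLift.
Variables (A : choiceType) (H : groupType) (f : A -> H).

Lemma word_eval_cat v w :
  word_eval f (v ++ w) = word_eval f v * word_eval f w.
Proof. by rewrite /word_eval big_cat. Qed.

Lemma word_eval_eq v w : pres_eq (@no_rel A) v w -> word_eval f v = word_eval f w.
Proof.
elim=> // [x y z _ -> _ -> //|x y [a b]].
rewrite !word_eval_cat; congr (_ * _); rewrite -[RHS]mul1g; congr (_ * _).
rewrite /word_eval !big_cons big_nil mulg1 /=.
by case: b; rewrite /= ?mulVg ?mulgV.
Qed.

Lemma free_liftE w : free_lift f (fcls w) = word_eval f w.
Proof. exact/word_eval_eq/reprcls. Qed.

Lemma free_lift_gen a : free_lift f (pgen (@no_rel A) a) = f a.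
Proof. by rewrite free_liftE /word_eval big_seq1. Qed.

Lemma free_liftM : {morph free_lift f : g h / g * h}.
Proof.
move=> g h; rewrite -[g](cls_repr g) -[h](cls_repr h) -clsM.
by rewrite !free_liftE word_eval_cat.
Qed.

Lemma free_lift1 : free_lift f 1 = 1.
Proof. by rewrite -cls1 free_liftE /word_eval big_nil. Qed.

End FreeLift.

Lemma word_eval_pgen (A : choiceType) (rel : word A -> word A -> Prop) w :
  word_eval (pgen rel) w = cls rel w.
Proof.
elim: w => [|[a b] w IHw]; first by rewrite /word_eval big_nil.
rewrite -cat1s word_eval_cat IHw clsM; congr (_ * _).
by rewrite /word_eval big_seq1 /=; case: b => //; rewrite /pgen -clsV.
Qed.

Lemma free_lift_pgen (A : choiceType) (rel : word A -> word A -> Prop) w :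
  free_lift (pgen rel) (fcls w) = cls rel w.
Proof. by rewrite free_liftE word_eval_pgen. Qed.

Lemma free_ball_max (X : finType) (P : free X -> Prop) (F : free X -> nat) n :
  P 1 ->
  let S := [set F g | g in [set g : free X | P g /\ (len g <= n)%N]] in
  S (max_nat S) /\ forall k, S k -> (k <= max_nat S)%N.
Proof.
move=> P1 S.
have lenP (g : free X) : exists2 w, fcls w = g & size w = len g.
  have [|[w wg sw] _] := @min_natP [set size w | w in [set w | fcls w = g]].
    by exists (size (repr g)); exists (repr g) => //; exact: cls_repr.
  by exists w.
have len1 : len (1 : free X) = 0%N.
  apply/eqP; rewrite -leqn0.
  have [|_ ->//] := @min_natP [set size w | w in [set w | fcls w = (1 : free X)]].
    by exists 0%N; exists [::].
  by exists [::].
apply: (@max_natP _ (\max_(w : {bseq n of X * bool}) F (fcls w))).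
  by exists (F 1); exists 1 => //; split=> //; rewrite len1.
move=> _ [g [_ gn] <-]; have [w wg sw] := lenP g.
have wn : (size w <= n)%N by rewrite sw.
rewrite -wg.
exact: (leq_bigmax (F := fun v : {bseq n of X * bool} => F (fcls v)) (Bseq wn)).
Qed.

Section Miller.
Variables (X : finType) (R : {fset word X}).

Definition relator_rel (l r : word X) : Prop := l \in R /\ r = [::].

Definition Ggroup : Type := pgroup relator_rel.
HB.instance Definition _ := Group.on Ggroup.

Definition trivial_in_G (g : free X) : Prop :=
  free_lift (pgen relator_rel) g = 1.

(* The letters of M(G); theta is indexed by the disjoint union of X and R. *)
Inductive miller_gen : Type :=
| gX of X
| gTheta of (X + R)%type
| gQ.

Definition miller_gen_code (a : miller_gen) : option (X + (X + R)) :=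
  match a with
  | gX x => Some (inl x)
  | gTheta a => Some (inr a)
  | gQ => None
  end.

Definition miller_gen_decode (c : option (X + (X + R))) : miller_gen :=
  match c with
  | Some (inl x) => gX x
  | Some (inr a) => gTheta a
  | None => gQ
  end.

Lemma miller_gen_codeK : cancel miller_gen_code miller_gen_decode.
Proof. by case. Qed.

HB.instance Definition _ := Countable.copy miller_gen (can_type miller_gen_codeK).
HB.instance Definition _ : isFinite miller_gen := CanIsFinite miller_gen_codeK.

Definition lX (x : X) : miller_gen * bool := (gX x, false).
Definition lTheta (a : X + R) : miller_gen * bool := (gTheta a, false).
Definition lQ : miller_gen * bool := (gQ, false).
Definition wX (w : word X) : word miller_gen := [seq (gX l.1, l.2) | l <- w].

Inductive miller_rel : word miller_gen -> word miller_gen -> Prop :=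
| miller_theta_X a x : miller_rel [:: lTheta a; lX x] [:: lX x; lTheta a]
| miller_theta_x x :
    miller_rel [:: lTheta (inl x); lX x; lQ] [:: lQ; lX x; lTheta (inl x)]
| miller_theta_r (r : R) :
    miller_rel [:: lTheta (inr r); lQ] (lQ :: wX (val r) ++ [:: lTheta (inr r)]).

Definition miller : Type := pgroup miller_rel.
HB.instance Definition _ := Group.on miller.

Definition q : miller := pgen miller_rel gQ.

(* F(X) -> M(G), x |-> x. This map is injective, and F(X) is identified with
   its image, the subgroup of M(G) generated by X. *)
Definition inFX : free X -> miller := free_lift (fun x => pgen miller_rel (gX x)).

(* The entry (w_j, (r, b)) stands for the factor w_j r_j w_j^-1, where r_j is
   r if b = false and r^-1 if b = true. *)
Definition expression : Type := seq (free X * (R * bool)).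

Definition relator_pm (rb : R * bool) : free X :=
  if rb.2 then (fcls (val rb.1))^-1 else fcls (val rb.1).

Definition expr_value (e : expression) : free X :=
  \prod_(c <- e) (c.1 * relator_pm c.2 * c.1^-1).

Definition expr_cost (e : expression) : nat :=
  if e is [::] then 0%N else
  let w := nth (1 : free X) [seq c.1 | c <- e] in
  let m := size e in
  (m + len (w 0) + len (w m.-1)
   + \sum_(i < m.-1) len ((w i)^-1 * w i.+1)%g)%N.

Definition lambda (g : free X) : nat :=
  min_nat [set expr_cost e | e in [set e | expr_value e = g]].

Definition Lambda (n : nat) : nat :=
  max_nat [set lambda g | g in
    [set g : free X | trivial_in_G g /\ (len g <= n)%N]].

Definition conjugate (H : groupType) (g h : H) : Prop :=
  exists c : H, g ^ c = h.

(* The convention for conjugation is immaterial here: a conjugator and its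
   inverse have the same length. *)
Definition min_conj_len (u : free X) : nat :=
  min_nat [set len c | c in [set c : miller | (q * inFX u) ^ c = q]].

Definition D0 (n : nat) : nat :=
  max_nat [set min_conj_len u | u in
    [set u : free X | conjugate q (q * inFX u) /\ (len u <= n - 2)%N]].

Definition tmax : nat := maxn (\max_(r : R) len (fcls (val r))) 2.

Lemma Lambda_attained n :
  exists g, [/\ trivial_in_G g, (len g <= n)%N, lambda g = Lambda n &
    forall h, trivial_in_G h -> (len h <= n)%N -> (lambda h <= Lambda n)%N].
Proof.
have [|[g [g1 gn] e] ub] := @free_ball_max X trivial_in_G lambda n.
  exact: free_lift1.
by exists g; split=> // h h1 hn; apply: ub; exists h.
Qed.

Lemma D0_attained n :
  exists u, [/\ conjugate q (q * inFX u), (len u <= n - 2)%N,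
    min_conj_len u = D0 n &
    forall v, conjugate q (q * inFX v) -> (len v <= n - 2)%N ->
      (min_conj_len v <= D0 n)%N].
Proof.
have [|[u [u1 un] e] ub] := @free_ball_max X
    (fun u => conjugate q (q * inFX u)) min_conj_len (n - 2).
  by exists 1; rewrite conjg1 /inFX free_lift1 mulg1.
by exists u; split=> // v v1 vn; apply: ub; exists v.
Qed.

End Miller.

(* Main.v *)
(** M(G) is the semidirect product of the free group on X and q by the free
group on Theta, where theta_x maps q to x^-1 q x, theta_r maps q to q r, and
both fix X. Following q through a word in Theta gives a^-1 q b with a, b in
F(X), and b a^-1 is the value of an expression read off the word: its x-letters
are the steps of the path 1, w_1, ..., w_m, 1 and its r-letters are the factors
r_j. Since Theta commutes with X, an expression of cost f conversely gives a
conjugator of length at most f, so D_0 <= Lambda. A conjugator of length k gives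
an expression of cost at most 2k, because each letter x contributes at both ends
of the path; hence Lambda <= 2 D_0, and 2 <= 3t. *)
From mathcomp Require Import all_boot all_order all_algebra finmap.
From mathcomp Require Import boolp classical_sets zify.
From HB Require Import structures.
Require Import Defs.
Import Order.TTheory GRing.Theory Num.Theory.

(** * The group of all bijections of a type *)

Section Bijections.
Set Implicit Arguments.
Unset Strict Implicit.
Local Open Scope group_scope.
Variable T : Type.

Record bijection := Bijection {
  bij_fun : T -> T;
  bij_inv : T -> T;
  bij_funK : cancel bij_fun bij_inv;
  bij_invK : cancel bij_inv bij_fun }.

HB.instance Definition _ := gen_eqMixin bijection.
HB.instance Definition _ := gen_choiceMixin bijection.

Lemma bijection_eq (f g : bijection) : bij_fun f =1 bij_fun g -> f = g.
Proof.
case: f g => [f f' fK f'K] [g g' gK g'K] /= /funext efg.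
rewrite {f}efg in fK f'K *.
have e : f' = g' by apply: funext => s; apply: (can_inj gK); rewrite f'K g'K.
by rewrite {f'}e in fK f'K *; congr Bijection; apply: Prop_irrelevance.
Qed.

Definition bij_one := @Bijection id id (frefl _) (frefl _).
(** The left factor acts first, so that right translation becomes a morphism. *)
Definition bij_mul (f g : bijection) :=
  Bijection (can_comp (bij_funK g) (bij_funK f))
            (can_comp (bij_invK f) (bij_invK g)).
Definition bij_opp (f : bijection) := Bijection (bij_invK f) (bij_funK f).

Fact bij_mulA : associative bij_mul.
Proof. by move=> f g h; apply: bijection_eq. Qed.

Fact bij_mul1g : left_id bij_one bij_mul.
Proof. by move=> f; apply: bijection_eq. Qed.

Fact bij_mulg1 : right_id bij_one bij_mul.
Proof. by move=> f; apply: bijection_eq. Qed.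

Fact bij_mulVg : left_inverse bij_one bij_opp bij_mul.
Proof. by move=> f; apply: bijection_eq => s /=; rewrite bij_invK. Qed.

Fact bij_mulgV : right_inverse bij_one bij_opp bij_mul.
Proof. by move=> f; apply: bijection_eq => s /=; rewrite bij_funK. Qed.

HB.instance Definition _ :=
  isGroup.Build bijection bij_mulA bij_mul1g bij_mulg1 bij_mulVg bij_mulgV.

Lemma bij_mulE (f g : bijection) s :
  bij_fun (f * g) s = bij_fun g (bij_fun f s).
Proof. by []. Qed.

Lemma bij_conj_fix (f c : bijection) s :
  bij_fun f s = s -> bij_fun (f ^ c) (bij_fun c s) = bij_fun c s.
Proof. by move=> fs; rewrite conjgE !bij_mulE /= bij_funK fs. Qed.

End Bijections.

(** * Permutations whose conjugacy class determines an element of a group *)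

Section Separation.
Set Implicit Arguments.
Unset Strict Implicit.
Local Open Scope group_scope.

Definition swap (T : eqType) (a b s : T) : T :=
  if s == a then b else if s == b then a else s.

Lemma swapK (T : eqType) (a b : T) : involutive (swap a b).
Proof.
move=> s; rewrite /swap; case: (eqVneq s a) => [->|sa].
  by rewrite eqxx; case: eqP.
by case: (eqVneq s b) => [->|sb]; rewrite ?eqxx ?(negPf sa) ?(negPf sb).
Qed.

Definition bij_swap (T : eqType) (a b : T) : bijection T :=
  Bijection (swapK a b) (swapK a b).

Variable F : groupType.
Local Notation S := (F * 'I_3)%type.

Fact rtrans_subproof (g : F) :
  cancel (fun s : S => (s.1 * g, s.2)) (fun s => (s.1 * g^-1, s.2)).
Proof. by case=> a i; rewrite /= mulgK. Qed.

Fact rtrans_subproofV (g : F) :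
  cancel (fun s : S => (s.1 * g^-1, s.2)) (fun s => (s.1 * g, s.2)).
Proof. by case=> a i; rewrite /= mulgVK. Qed.

Definition rtrans (g : F) : bijection S :=
  Bijection (rtrans_subproof g) (rtrans_subproofV g).

Lemma rtransM : {morph rtrans : g h / g * h}.
Proof. by move=> g h; apply: bijection_eq => s; rewrite bij_mulE /= mulgA. Qed.

Lemma rtrans1 : rtrans 1 = 1.
Proof. by apply: bijection_eq => -[a i]; rewrite /= mulg1. Qed.

HB.instance Definition _ :=
  isUMagmaMorphism.Build F (bijection S) rtrans (rtrans1, rtransM).

Fact shift_subproof :
  cancel (fun s : S => (s.1, ordS s.2)) (fun s => (s.1, ord_pred s.2)).
Proof. by case=> a i; rewrite /= ordSK. Qed.

Fact shift_subproofV :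
  cancel (fun s : S => (s.1, ord_pred s.2)) (fun s => (s.1, ordS s.2)).
Proof. by case=> a i; rewrite /= ord_predK. Qed.

Definition shift : bijection S := Bijection shift_subproof shift_subproofV.

(* [detector u * rtrans v] has a fixed point exactly when [v = u], so that it is
   conjugate to [detector u * rtrans u] only for [v = u]. A third sheet is
   needed: with two, [v = u^-1] would also produce a fixed point. *)
Definition detector (u : F) : bijection S :=
  shift * bij_swap (1, ordS ord0) (u^-1, ord0).

Lemma detector_fix u : bij_fun (detector u * rtrans u) (1, ord0) = (1, ord0).
Proof. by rewrite !bij_mulE /= /swap eqxx /= mulVg. Qed.

Lemma detector_fixP u v s : bij_fun (detector u * rtrans v) s = s -> v = u.
Proof.
rewrite !bij_mulE /= /swap; case: s => a i /=.
(* Only a point shifted to [(1, ordS ord0)] can return to its own sheet; the other cases would give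
   [1 + 1 = 0] or [i + 1 = i] modulo 3. *)
case: eqP => [[-> ei]|_] /=; first by case=> /mulg1_eq; rewrite invgK.
case: eqP => [[_ ei] [_ ei']|_ [_ ei]] /=; exfalso; move: ei.
  by rewrite -ei'.
by case: i => [[|[|[|]]]].
Qed.

Lemma detector_conj u v c :
  (detector u * rtrans u) ^ c = detector u * rtrans v -> v = u.
Proof.
move=> e; apply: (@detector_fixP _ _ (bij_fun c (1, ord0))).
by rewrite -e; apply: bij_conj_fix; apply: detector_fix.
Qed.

End Separation.

(** * Word length in a presented group *)

Section Length.
Set Implicit Arguments.
Unset Strict Implicit.
Local Open Scope group_scope.
Variables (A : choiceType) (rel : word A -> word A -> Prop).
Implicit Types g h : pgroup rel.

Lemma len_word g : exists2 w, cls rel w = g & size w = len g.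
Proof.
have [|[w wg sw] _] := @min_natP
    [set size w | w in [set w | cls rel w = g]]%classic.
  by exists (size (repr g)), (repr g) => //; apply: cls_repr.
by exists w.
Qed.

Lemma len_cls w : (len (cls rel w) <= size w)%N.
Proof.
have [|_ ->//] := @min_natP
    [set size v | v in [set v | cls rel v = cls rel w]]%classic.
  by exists (size w), w.
by exists w.
Qed.

Lemma len1 : len (1 : pgroup rel) = 0%N.
Proof. by apply/eqP; rewrite -leqn0; apply: len_cls [::]. Qed.

Lemma lenM g h : (len (g * h)%g <= len g + len h)%N.
Proof.
have [[v <- <-] [w <- <-]] := (len_word g, len_word h).
by rewrite -clsM -size_cat; apply: len_cls.
Qed.

Lemma len_inv_le g : (len (g^-1)%g <= len g)%N.
Proof.
have [v <- <-] := len_word g; rewrite -clsV.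
by apply: leq_trans (len_cls _) _; rewrite /word_inv size_rev size_map.
Qed.

Lemma lenV g : len g^-1 = len g.
Proof. by apply/eqP; rewrite eqn_leq len_inv_le -{1}[g]invgK len_inv_le. Qed.

Lemma len_gen a : (len (pgen rel a) <= 1)%N.
Proof. exact: len_cls. Qed.

End Length.

(** * Morphisms out of a free group *)

Section FreeMorphisms.
Set Implicit Arguments.
Unset Strict Implicit.
Local Open Scope group_scope.
Variable A : choiceType.

HB.instance Definition _ (H : groupType) (f : A -> H) :=
  isUMagmaMorphism.Build (free A) H (free_lift f)
    (free_lift1 f, free_liftM f).

Lemma fcls1 : fcls [::] = 1 :> free A.
Proof. by []. Qed.

Lemma fclsM v w : fcls (v ++ w) = fcls v * fcls w :> free A.
Proof. exact: clsM. Qed.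

Lemma fclsV w : fcls (word_inv w) = (fcls w)^-1 :> free A.
Proof. exact: clsV. Qed.

Lemma free_ind (P : free A -> Prop) :
  P 1 -> (forall a b g, P g -> P (fcls [:: (a, b)] * g)) ->
  forall g, P g.
Proof.
move=> P1 PM g; rewrite -(cls_repr g); elim: (repr g) => // [[a b] w IHw].
by rewrite -cat1s clsM; apply: PM.
Qed.

Lemma len_free_lift (B : choiceType) (rel : word B -> word B -> Prop)
    (f : A -> pgroup rel) g :
  (forall a, len (f a) <= 1)%N -> (len (free_lift f g) <= len g)%N.
Proof.
move=> f1; have [w <- <-] := len_word g; rewrite free_liftE.
elim: w => [|[a b] w IHw]; first by rewrite /word_eval big_nil len1.
rewrite -cat1s word_eval_cat; apply: leq_trans (lenM _ _) _.
rewrite -[size _]add1n leq_add // /word_eval big_seq1.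
by case: b => /=; rewrite ?lenV.
Qed.

End FreeMorphisms.

(** * Products of conjugates of relators and their cost *)

Section Expressions.
Set Implicit Arguments.
Unset Strict Implicit.
Local Open Scope group_scope.
Variables (X : finType) (R : {fset word X}).
Implicit Types (e : expression R) (g u w : free X) (rb : R * bool).

Lemma expr_value_cons w rb e :
  expr_value ((w, rb) :: e) = w * relator_pm rb * w^-1 * expr_value e.
Proof. by rewrite /expr_value big_cons. Qed.

Lemma expr_value_cat e1 e2 :
  expr_value (e1 ++ e2) = expr_value e1 * expr_value e2.
Proof. by rewrite /expr_value big_cat. Qed.

Lemma relator_pmN (r : R) b : relator_pm (r, ~~ b) = (relator_pm (r, b))^-1.
Proof. by case: b => //=; rewrite /relator_pm /= invgK. Qed.

Lemma expr_inv e : exists e', expr_value e' = (expr_value e)^-1.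
Proof.
elim: e => [|[w [r b]] e [e' IHe]].
  by exists [::]; rewrite /expr_value !big_nil invg1.
exists (e' ++ [:: (w, (r, ~~ b))]); rewrite expr_value_cat !expr_value_cons IHe.
by rewrite /expr_value big_nil relator_pmN mulg1 !invgM invgK !mulgA.
Qed.

Definition expr_conj g e : expression R := [seq (g * c.1, c.2) | c <- e].

Lemma expr_value_conj g e :
  expr_value (expr_conj g e) = g * expr_value e * g^-1.
Proof.
elim: e => [|[w rb] e IHe]; first by rewrite /expr_value !big_nil mulg1 mulgV.
by rewrite /= !expr_value_cons IHe invgM !mulgA mulgVK.
Qed.

(* The cost of [e] with the path w_1, ..., w_m, 1 started at [w0] instead of 1;
   this form of [expr_cost] is recursive in [e]. *)
Fixpoint path_cost w0 e : nat :=
  if e is c :: e' then (len (w0^-1 * c.1)%g + 1 + path_cost c.1 e')%N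
  else len w0.

(** The summand [m] is spread as 1 per factor, and the length of [w_m] is the return to 1. An
    arbitrary start [w0] lets the induction go through. *)
Lemma expr_costE e : expr_cost e = path_cost 1 e.
Proof.
case: e => [|c e]; first by rewrite /= len1.
suff H w0 : path_cost w0 (c :: e) =
    (len (w0^-1 * c.1)%g + ((size e).+1
     + len (nth 1%g [seq d.1 | d <- c :: e] (size e))
     + \sum_(i < size e) len ((nth 1%g [seq d.1 | d <- c :: e] i)^-1
                              * nth 1%g [seq d.1 | d <- c :: e] i.+1)%g))%N.
  by rewrite H /expr_cost /= invg1 mul1g; lia.
elim: e c w0 => [|d e IHe] c w0; first by rewrite /= big_ord0 addn0 addnA.
have -> : path_cost w0 [:: c, d & e]
  = (len (w0^-1 * c.1)%g + 1 + path_cost c.1 (d :: e))%N by [].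
rewrite IHe big_ord_recl.
have reorder a b k l s :
    (a + 1 + (b + (k + l + s)) = a + (k.+1 + l + (b + s)))%N.
  by lia.
exact: reorder.
Qed.

Lemma path_cost_start w0 w1 e :
  (path_cost w0 e <= len (w0^-1 * w1)%g + path_cost w1 e)%N.
Proof.
case: e => [|c e] /=.
  rewrite -[X in (X <= _)%N]lenV -[X in (_ <= _ + X)%N]lenV.
  by apply: leq_trans (lenM _ _); rewrite mulgK.
rewrite !addnA !leq_add2r; apply: leq_trans (lenM _ _).
by rewrite mulgA mulgK.
Qed.

(** Left translation preserves all steps of the path; only the return to 1 changes. *)
Lemma path_cost_conj g w0 e :
  (path_cost (g * w0)%g (expr_conj g e) <= len g + path_cost w0 e)%N.
Proof.
elim: e w0 => [|c e IHe] w0 /=; first exact: lenM.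
by rewrite invgM -mulgA mulKg addnCA leq_add2l.
Qed.

(** The translated path must be reached from 1 and left again, each for at most [len g]. This
    doubling is the source of the factor 2 in the lower bound. *)
Lemma expr_cost_conj g e :
  (expr_cost (expr_conj g e) <= expr_cost e + (len g).*2)%N.
Proof.
rewrite !expr_costE -addnn addnCA.
apply: leq_trans (path_cost_start 1 g _) _.
rewrite invg1 mul1g leq_add2l addnC -[X in path_cost X _]mulg1.
exact: path_cost_conj.
Qed.

Lemma expr_cost_cons1 rb e : expr_cost ((1, rb) :: e) = (expr_cost e).+1.
Proof. by rewrite !expr_costE /= invg1 mulg1 len1. Qed.

(** The kernel of F(X) -> G is the normal closure of R. *)
Lemma trivial_in_GP u :
  trivial_in_G R u <-> exists e : expression R, expr_value e = u.
Proof.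
split=> [u1|[e <-]]; last first.
  rewrite /trivial_in_G /expr_value gmulf_prod; apply: big1 => [[w [r b]]] _ /=.
  suff rel1 : free_lift (pgen (relator_rel R)) (relator_pm (r, b)) = 1.
    by rewrite !gmulfM gmulfV /= rel1 mulg1 mulgV.
  suff r1 : free_lift (pgen (relator_rel R)) (fcls (val r)) = 1.
    by case: b; rewrite /relator_pm /= ?gmulfV /= r1 ?invg1.
  rewrite free_lift_pgen; apply/clsP.
  by have := @pres_rel _ (relator_rel R) [::] [::] (val r) [::];
    rewrite !cats0; apply; split=> //; apply: valP.
(* Induction on a derivation of [v = w]: deleting a relator [l] after a prefix [v] contributes the
   factor [v l v^-1], and free cancellation contributes nothing. *)
suff main (v w : word X) : pres_eq (relator_rel R) v w ->
    exists e : expression R, expr_value e = fcls v * (fcls w)^-1.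
  have /main [e eE] : pres_eq (relator_rel R) (repr u) [::].
    by apply/clsP; rewrite -free_lift_pgen /fcls cls_repr; exact: u1.
  by exists e; rewrite eE /fcls cls1 invg1 mulg1 cls_repr.
elim=> {v w} [w|v w _ [e eE]|v w z _ [e eE] _ [e' eE']|v w l|v w l _ [Rl ->]].
- by exists [::]; rewrite /expr_value big_nil mulgV.
- by have [e' e'E] := expr_inv e; exists e'; rewrite e'E eE invgM invgK.
- by exists (e ++ e'); rewrite expr_value_cat eE eE' mulgA mulgVK.
- exists [::]; rewrite /expr_value big_nil.
  have -> : fcls (v ++ [:: l; letter_inv l] ++ w) = fcls (v ++ w).
    exact/clsP/pres_cancel.
  by rewrite mulgV.
exists [:: (fcls v, ([` Rl]%fset, false))].
rewrite expr_value_cons /expr_value big_nil mulg1 /relator_pm /=.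
by rewrite /fcls /= !clsM invgM !mulgA mulgK.
Qed.

End Expressions.

(** * From conjugators to expressions: an action of M(G) on pairs *)

Section MillerAction.
Set Implicit Arguments.
Unset Strict Implicit.
Local Open Scope group_scope.
Variables (X : finType) (R : {fset word X}).
Implicit Types (w : word (miller_gen R)) (v : word X).

Definition letter_val (G : groupType) (b : bool) (g : G) : G :=
  if b then g^-1 else g.

Section Action.
Variables (H : groupType) (i : UMagmaMorphism.type (free X) H).

(* A right action of M(G): the first component is the current image of q, which
   only Theta changes; the second accumulates the letters of X and q. *)
Definition act (t : H * H) (l : miller_gen R * bool) : H * H :=
  match l.1 with
  | gX x => (t.1, t.2 * letter_val l.2 (i (fcls [:: (x, false)])))
  | gQ => (t.1, t.2 * letter_val l.2 t.1)
  | gTheta (inl x) => (t.1 ^ letter_val l.2 (i (fcls [:: (x, false)])), t.2)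
  | gTheta (inr r) => (t.1 * letter_val l.2 (i (fcls (val r))), t.2)
  end.

Definition run := foldl act.

Lemma run_cat t w1 w2 : run t (w1 ++ w2) = run (run t w1) w2.
Proof. exact: foldl_cat. Qed.

Lemma act_inv t l : act (act t l) (letter_inv l) = t.
Proof.
case: t l => p h [[x|[x|r]|] []]; rewrite /act /=;
by rewrite ?mulgK ?mulgVK ?conjgK ?conjgKV.
Qed.

Lemma morph_letter x b :
  i (fcls [:: (x, b)]) = letter_val b (i (fcls [:: (x, false)])).
Proof. by case: b => //=; rewrite -gmulfV -fclsV. Qed.

Lemma run_wX p h v : run (p, h) (wX R v) = (p, h * i (fcls v)).
Proof.
elim: v h => [|[x b] v IHv] h; first by rewrite fcls1 gmulf1 mulg1.
by rewrite -cat1s fclsM gmulfM morph_letter mulgA /= IHv.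
Qed.

Lemma run_rel l r t : miller_rel l r -> run t l = run t r.
Proof.
case: t => p h; case=> [[x|r'] y|x|r'] /=.
- by [].
- by [].
- by rewrite /act /= conjgE !mulgA mulgK.
- by rewrite /act /= run_cat run_wX /= !mulgA.
Qed.

Lemma run_eq w1 w2 :
  pres_eq (@miller_rel X R) w1 w2 -> forall t, run t w1 = run t w2.
Proof.
elim=> // {w1 w2} [? ? ? _ IH1 _ IH2 t|? ? l t|? ? l r lr t].
- by rewrite IH1 IH2.
- by rewrite !run_cat /= act_inv.
- by rewrite !run_cat (run_rel _ lr).
Qed.

(** Letters multiply the second component on the right only, so left factors pass through a run. *)
Lemma run_mul p h k w :
  run (p, h * k) w = ((run (p, k) w).1, h * (run (p, k) w).2).
Proof.
elim: w p k => [|[[x|[x|r]|] b] w IHw] p k //=;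
by rewrite /act /= -?mulgA IHw.
Qed.

(** Induction from the front of [w]: a first letter theta_x conjugates the remaining expression by
    x, theta_r prepends a factor at the vertex 1, and X and q leave the first component alone. As
    the first letter alters [p], the equation must hold for every [p]. *)
Lemma run_expr w : exists e : expression R, exists a : H,
  (expr_cost e <= (size w).*2)%N /\
  forall p h, (run (p, h) w).1 = (p * i (expr_value e)) ^ a.
Proof.
elim: w => [|[[x|[x|r]|] b] w [e [a [le_e runE]]]].
- exists [::], 1; split=> // p h.
  by rewrite /expr_value big_nil gmulf1 mulg1 conjg1.
- by exists e, a; split=> [|p h]; [rewrite /=; lia | rewrite /= runE].
- set y := fcls [:: (x, b)].
  exists (expr_conj y e), (i y * a); split=> [|p h].
    apply: leq_trans (expr_cost_conj _ _) _.
    have y1 : (len y <= 1)%N by apply: len_cls.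
    by rewrite [size _]/= doubleS -addn2 leq_add // -[2]/(1.*2) leq_double.
  rewrite /= runE -morph_letter -/y expr_value_conj !gmulfM gmulfV conjgM.
  by congr (_ ^ a); rewrite !conjgE !mulgA mulgVK.
- exists ((1, (r, b)) :: e), a; split=> [|p h].
    by rewrite expr_cost_cons1 /= doubleS; lia.
  rewrite /= runE expr_value_cons invg1 mulg1 mul1g gmulfM mulgA.
  by case: b => //=; rewrite -gmulfV.
- by exists e, a; split=> [|p h]; [rewrite /=; lia | rewrite /= runE].
Qed.

End Action.

Lemma inFX_fcls v : inFX R (fcls v) = cls _ (wX R v).
Proof.
rewrite /inFX free_liftE; elim: v => [|[x b] v IHv].
  by rewrite /word_eval big_nil.
rewrite -cat1s word_eval_cat IHv /= -[_ :: wX R v]cat1s clsM; congr (_ * _).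
by rewrite -word_eval_pgen /word_eval !big_seq1.
Qed.

(** The expression [e] read off a word for [c] has value v with q u and q v conjugate in every group
    where the action is run. Taking permutations, with [detector u] for q and right translations for
    F(X), forces v = u. *)
Lemma conj_expr u (c : miller R) : (q R * inFX R u) ^ c = q R ->
  exists2 e : expression R, expr_value e = u & (expr_cost e <= (len c).*2)%N.
Proof.
have [w wc <-] := len_word c; rewrite -wc => /(congr1 (fun g => cls _ w * g)).
rewrite conjgE mulVKg => qu.
(* The conjugacy, written as the equality of words q u w = w q, can be fed to the action. *)
have /run_eq runE : pres_eq (@miller_rel X R)
    (lQ R :: wX R (repr u) ++ w) (w ++ [:: lQ R]).
  apply/clsP; rewrite clsM -qu -cat1s !clsM mulgA; congr (_ * _ * _).
  by rewrite -inFX_fcls /fcls cls_repr.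
pose i : UMagmaMorphism.type (free X) (bijection (free X * 'I_3)) :=
  @rtrans (free X).
have [e [a [le_e runwE]]] := run_expr i w; exists e => //.
(* In the second component the hypothesis reads p u b = b (p v)^a. *)
pose p := detector u.
have := congr1 snd (runE _ i (p, 1)).
rewrite -cat1s !run_cat run_wX /fcls cls_repr /= mul1g.
rewrite -[p * i u]mulg1 run_mul runwE /= => pE.
pose b := (run i (p, 1) w).2.
(* Here (p u)^b = (p v)^a, so [b * a^-1] conjugates p u to p v. *)
apply: (@detector_conj _ _ _ (b * a^-1)).
have : (detector u * rtrans u) ^ b = (p * i (expr_value e)) ^ a.
  by rewrite conjgE pE mulKg.
by rewrite conjgM => ->; rewrite conjgK.
Qed.

End MillerAction.

(** * From expressions to conjugators: words in Theta *)

Section ThetaWords.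
Set Implicit Arguments.
Unset Strict Implicit.
Local Open Scope group_scope.
Variables (X : finType) (R : {fset word X}).
Implicit Types (u g : free X) (e : expression R) (rb : R * bool).
Local Notation M := (miller R).
Local Notation gen := (pgen (@miller_rel X R)).
Local Notation q := (q R).
Local Notation inFX := (inFX R).

HB.instance Definition _ :=
  isUMagmaMorphism.Build (free X) M inFX
    (free_lift1 (fun x => gen (gX R x)), free_liftM (fun x => gen (gX R x))).

Definition thetaX : free X -> M :=
  free_lift (fun x => gen (gTheta (inl x : X + R))).

Definition theta_pm rb : M :=
  letter_val rb.2 (gen (gTheta (inr rb.1 : X + R))).

HB.instance Definition _ :=
  isUMagmaMorphism.Build (free X) M thetaX
    (free_lift1 (fun x => gen (gTheta (inl x : X + R))),
     free_liftM (fun x => gen (gTheta (inl x : X + R)))).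

Lemma inFX_letter x b : inFX (fcls [:: (x, b)]) = letter_val b (gen (gX R x)).
Proof. by rewrite /inFX free_liftE /word_eval big_seq1. Qed.

Lemma thetaX_letter x b :
  thetaX (fcls [:: (x, b)]) = letter_val b (gen (gTheta (inl x : X + R))).
Proof. by rewrite /thetaX free_liftE /word_eval big_seq1. Qed.

Lemma commute_letter_val (G : groupType) (g h : G) b :
  commute g h -> commute g (letter_val b h).
Proof. by case: b => //; apply: commuteV. Qed.

Lemma commute_inFX (c : M) u :
  (forall x, commute c (gen (gX R x))) -> commute c (inFX u).
Proof.
move=> cX; elim/free_ind: u => [|x b u IHu].
  by rewrite gmulf1; apply: commute1.
rewrite gmulfM; apply: commuteM => //=.
by rewrite inFX_letter; apply: commute_letter_val.
Qed.

Lemma commute_theta_inFX (a : X + R) u : commute (inFX u) (gen (gTheta a)).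
Proof.
apply/commute_sym/commute_inFX => x; rewrite /commute /pgen -!clsM.
exact/clsP/(pres_rel [::] [::] (miller_theta_X a x)).
Qed.

Lemma commute_theta_pm rb u : commute (inFX u) (theta_pm rb).
Proof. exact/commute_letter_val/commute_theta_inFX. Qed.

Lemma commute_thetaX g u : commute (inFX u) (thetaX g).
Proof.
elim/free_ind: g => [|x b g IHg]; first by rewrite gmulf1; apply: commute1.
rewrite gmulfM; apply: commuteM => //=; rewrite thetaX_letter.
exact/commute_letter_val/commute_theta_inFX.
Qed.

Lemma conjg_commute (G : groupType) (a b c : G) :
  commute b c -> (a ^ b) ^ c = (a ^ c) ^ b.
Proof. by move=> bc; rewrite -!conjgM bc. Qed.

Lemma conjg_id (G : groupType) (a b : G) : commute a b -> a ^ b = a.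
Proof. by move=> ab; rewrite conjgE ab mulKg. Qed.

(** As theta_x commutes with x, the relation theta_x x q = q x theta_x says theta_x q theta_x^-1 =
    x^-1 q x. Letters compose in the right order because Theta commutes with F(X). *)
Lemma conjg_q_thetaX g : q ^ (thetaX g)^-1 = q ^ inFX g.
Proof.
have cX x : commute (gen (gX R x)) (gen (gTheta (inl x : X + R))).
  have := commute_theta_inFX (inl x) (fcls [:: (x, false)]).
  by rewrite inFX_letter.
have qx x : q ^ (gen (gTheta (inl x : X + R)))^-1 = q ^ gen (gX R x).
  have rel : gen (gTheta (inl x : X + R)) * (gen (gX R x) * q) =
      q * (gen (gX R x) * gen (gTheta (inl x : X + R))).
    rewrite /Defs.q /pgen -!clsM.
    exact/clsP/(pres_rel [::] [::] (miller_theta_x R x)).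
  rewrite !conjgE invgK; apply: (@mulgI _ (gen (gX R x))).
  by rewrite mulVKg !mulgA cX -(mulgA _ _ q) rel !mulgA mulgK.
elim/free_ind: g => [|x b g IHg]; first by rewrite !gmulf1 invg1.
rewrite [inFX _]gmulfM [thetaX _]gmulfM /= invgM conjgM IHg conjgM.
set th := thetaX (fcls _); set y := inFX (fcls _).
suff qy : q ^ th^-1 = q ^ y.
  by rewrite -qy; apply: conjg_commute; apply/commuteV/commute_thetaX.
rewrite /th /y inFX_letter thetaX_letter.
case: b {th y} => //=; rewrite invgK.
(* For an inverse letter the claim becomes (q^theta_x)^x = q, where the two conjugations commute and
   cancel by [qx]. *)
apply: (canRL (conjgK (gen (gX R x)))).
by rewrite (conjg_commute _ (commute_sym (cX x))) -qx conjgKV.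
Qed.

Lemma conjg_q_theta_pm rb : q ^ (theta_pm rb)^-1 = q * inFX (relator_pm rb).
Proof.
case: rb => r b; pose th := gen (gTheta (inr r : X + R)).
have qr : q ^ th^-1 = q * inFX (fcls (val r)).
  have rel : th * q = q * (inFX (fcls (val r)) * th).
    rewrite inFX_fcls /th /Defs.q /pgen -(clsM _ (wX R _)) -!clsM; apply/clsP.
    by have := pres_rel [::] [::] (miller_theta_r r); rewrite !cats0.
  by rewrite conjgE invgK mulgA rel mulgA mulgK.
case: b; rewrite /theta_pm /relator_pm //= invgK -/th.
(* Conjugating q^(theta_r^-1) = q r by theta_r, which fixes r, gives q = q^theta_r r. *)
have := congr1 (fun g : M => g ^ th) qr; rewrite conjgKV conjMg.
by rewrite (conjg_id (commute_theta_inFX _ _)) gmulfV => {2}->; rewrite mulgK.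
Qed.

(** The conjugator spells the path in Theta: theta-words for the steps, one letter theta_r^{+-1} per
    factor, and a final theta-word back to 1. Its length is thus bounded by the cost. *)
Lemma expr_conj_path w0 e : exists2 c : M,
  (len c <= path_cost w0 e)%N &
  q ^ c^-1 = q ^ (inFX w0)^-1 * inFX (expr_value e).
Proof.
elim: e w0 => [|[w rb] e IHe] w0 /=.
  exists (thetaX w0^-1).
    by rewrite -[X in (_ <= X)%N]lenV; apply: len_free_lift => x;
      apply: len_gen.
  by rewrite conjg_q_thetaX gmulfV /expr_value big_nil gmulf1 mulg1.
have [c le_c qc] := IHe w.
exists (thetaX (w0^-1 * w) * theta_pm rb * c).
  apply: leq_trans (lenM _ _) _; rewrite leq_add //.
  apply: leq_trans (lenM _ _) _; rewrite leq_add //.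
    by apply: len_free_lift => x; apply: len_gen.
  by rewrite /theta_pm /letter_val; case: rb.2; rewrite ?lenV len_gen.
have commV (a b : M) : commute a b -> commute a^-1 b^-1.
  by move=> ab; apply/commuteV/commute_sym/commuteV/commute_sym.
rewrite !invgM !conjgM qc [_ ^ (theta_pm rb)^-1]conjMg.
rewrite (conjg_id (commuteV (commute_theta_pm _ _))).
rewrite (conjg_commute _ (commV _ _ (commute_theta_pm _ _))) conjg_q_theta_pm.
(* Conjugating q r by w^-1 splits off w r w^-1, exactly the new factor of the expression. *)
have -> : (q * inFX (relator_pm rb)) ^ (inFX w)^-1 * inFX (expr_value e) =
    q ^ (inFX w)^-1 * inFX (expr_value ((w, rb) :: e)).
  by rewrite expr_value_cons !gmulfM gmulfV /= !conjgE invgK !mulgA mulgVK.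
rewrite [_ ^ (thetaX _)^-1]conjMg (conjg_id (commuteV (commute_thetaX _ _))).
rewrite (conjg_commute _ (commV _ _ (commute_thetaX _ _))) conjg_q_thetaX.
by rewrite gmulfM gmulfV /= conjgM conjgK.
Qed.

Lemma expr_conjugator e : exists2 c : M,
  (q * inFX (expr_value e)) ^ c = q & (len c <= expr_cost e)%N.
Proof.
have [c le_c qc] := expr_conj_path 1 e; exists c; last by rewrite expr_costE.
by rewrite gmulf1 invg1 conjg1 in qc; rewrite -qc conjgKV.
Qed.

End ThetaWords.

(** * Comparison of the two minima, then of their maxima *)

Section Comparison.
Set Implicit Arguments.
Unset Strict Implicit.
Local Open Scope group_scope.
Variables (X : finType) (R : {fset word X}).
Implicit Types u : free X.

(** [D0 n] and [Lambda (n - 2)] are therefore maxima over the same elements [u], and a pointwise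
    comparison suffices. *)
Lemma conjugateP u :
  conjugate (q R) (q R * inFX R u) <-> trivial_in_G R u.
Proof.
split=> [[c qc]|/trivial_in_GP [e <-]]; last first.
  have [c qc _] := expr_conjugator e.
  by exists c^-1; rewrite -{1}qc conjgK.
have [e eu _] : exists2 e : expression R,
    expr_value e = u & (expr_cost e <= (len c^-1).*2)%N.
  by apply: conj_expr; rewrite -qc conjgK.
by apply/trivial_in_GP; exists e.
Qed.

Lemma lambda_attained u : trivial_in_G R u ->
  exists2 e : expression R, expr_value e = u & expr_cost e = lambda R u.
Proof.
case/trivial_in_GP => e eu.
have [|[e' e'u e'E] _] :=
    @min_natP [set expr_cost e | e in
      [set e : expression R | expr_value e = u]]%classic.
  by exists (expr_cost e), e.
by exists e'.
Qed.

Lemma lambda_le (e : expression R) : (lambda R (expr_value e) <= expr_cost e)%N.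
Proof.
have [|_ ->//] := @min_natP
    [set expr_cost f | f in
      [set f : expression R | expr_value f = expr_value e]]%classic.
  by exists (expr_cost e), e.
by exists e.
Qed.

(** Some conjugator exists, so the minimum is attained and is not the default 0. *)
Lemma min_conj_lenP u : trivial_in_G R u ->
  (exists2 c : miller R, (q R * inFX R u) ^ c = q R &
     len c = min_conj_len R u) /\
  forall c : miller R, (q R * inFX R u) ^ c = q R ->
    (min_conj_len R u <= len c)%N.
Proof.
case/trivial_in_GP => e <-; have [c qc _] := expr_conjugator e.
have [|[c' qc' c'E] minc] := @min_natP
    [set len c | c in
      [set c : miller R | (q R * inFX R (expr_value e)) ^ c = q R]]%classic.
  by exists (len c), c.
by split=> [|d qd]; [exists c' | apply: minc; exists d].
Qed.

Lemma min_conj_len_le_lambda u :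
  trivial_in_G R u -> (min_conj_len R u <= lambda R u)%N.
Proof.
move=> u1; have [_ minc] := min_conj_lenP u1.
have [e eu <-] := lambda_attained u1; rewrite -eu in minc *.
by have [c qc] := expr_conjugator e; apply/leq_trans/minc.
Qed.

Lemma lambda_le_min_conj_len u :
  trivial_in_G R u -> (lambda R u <= (min_conj_len R u).*2)%N.
Proof.
move=> u1; have [[c qc <-] _] := min_conj_lenP u1.
by have [e <-] := conj_expr qc; apply/leq_trans/lambda_le.
Qed.

Lemma D0_le_Lambda n : (D0 R n <= Lambda R (n - 2))%N.
Proof.
have [u [/conjugateP u1 un <- _]] := D0_attained R n.
have [_ [_ _ _ /(_ u u1 un)]] := Lambda_attained R (n - 2).
exact/leq_trans/min_conj_len_le_lambda.
Qed.

Lemma Lambda_le_D0 n : (Lambda R (n - 2) <= (D0 R n).*2)%N.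
Proof.
have [u [u1 un <- _]] := Lambda_attained R (n - 2).
have [_ [_ _ _ maxu]] := D0_attained R n.
apply: leq_trans (lambda_le_min_conj_len u1) _; rewrite leq_double.
by apply: maxu => //; apply/conjugateP.
Qed.

End Comparison.

(** * The stated bounds with constant 3t *)

Local Open Scope ring_scope.

Theorem theoremB (X : finType) (R : {fset word X}) (HR : R != fset0)
    (HXR : forall x : X, [:: (x, false)] \notin R) (n : nat) (hn : (2 < n)%N) :
  (Lambda R (n - 2))%:R / (3 * tmax R)%:R <= (D0 R n)%:R :> rat
  /\ (D0 R n <= Lambda R (n - 2))%N.
Proof.
split; last exact: D0_le_Lambda.
have t2 : (2 <= tmax R)%N by apply: leq_maxr.
rewrite ler_pdivrMr; last by rewrite ltr0n muln_gt0 /= (leq_trans _ t2).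
rewrite -natrM ler_nat; apply: leq_trans (Lambda_le_D0 R n) _.
(* The constant 2 is weakened through 2 <= t <= 3t. *)
by rewrite -muln2 leq_mul // (leq_trans t2) // leq_pmull.
Qed.
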